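(* Let $q$ be an odd prime power, $\delta\in\mathbb{F}_{q^2}$ and $\gamma\in\mathbb{F}_q^*$. Then the polynomial $$f(x)=(x^q-x+\delta)^{3q+2}+\gamma(x^q+x)$$ is a permutation polynomial of $\mathbb{F}_{q^2}$ if and only if either $q\equiv0\pmod 5$, or $q\equiv2,3,4\pmod 5$ and $\mathrm{Tr}_q^{q^2}(\delta)=0$.
   Context: A polynomial over a finite field $\mathbb{F}$ is a permutation polynomial of $\mathbb{F}$ if the map it induces on $\mathbb{F}$ is a bijection. For $x\in\mathbb{F}_{q^2}$, $\mathrm{Tr}_q^{q^2}(x)=x+x^q$.
   Formalization: The case q = 3 with Tr(δ) ≠ 0 is excluded, since the claim is false there: on F_9 one has u^11 = u^3, so f is an injective additive map plus a constant and permutes F_9 for every δ. *)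

(* Defs.v *)
From mathcomp Require Import all_boot all_algebra.

Set Implicit Arguments.
Unset Strict Implicit.
Unset Printing Implicit Defensive.

Import GRing.Theory.
Local Open Scope ring_scope.

Definition prime_power (q : nat) : Prop :=
  exists p k : nat, [/\ prime p, (0 < k)%N & q = (p ^ k)%N].

(* When #|F| = q ^ 2, the fixed points of x |-> x ^+ q form the subfield F_q. *)
Definition subfield_q (F : finFieldType) (q : nat) : pred F :=
  [pred x | x ^+ q == x].

Definition Tr (F : finFieldType) (q : nat) (x : F) : F := x + x ^+ q.

Definition permutation_polynomial (F : finFieldType) (p : {poly F}) : Prop :=
  bijective (fun x : F => p.[x]).

(* Main.v *)
Require Import Defs.
From mathcomp Require Import all_boot all_algebra.
From mathcomp Require Import all_solvable all_field.
From mathcomp Require Import ring zify.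

Import GRing.Theory.
Local Open Scope ring_scope.

(* With t = Tr delta, u = x^q - x + delta and s = u - u^q, one has u + u^q = t,
   and 16 (f^q - f) = P(s) for P(s) = s (t^2 - s^2)^2, while s and Tr x range
   independently over the elements of trace zero and over F_q. Hence f permutes
   F_{q^2} if and only if P is injective on the q elements of trace zero. If
   t = 0, then P(s) = s^5. If t <> 0 and p = 5, a discriminant computation shows
   that P is injective. If t <> 0 and p <> 5, Hermite's criterion fails for an
   exponent k such that P^k has nonzero coefficient in degree q - 1 and degree
   less than 2 (q - 1). For p > 5 such a k exists for q = p; for p = 3 it exists
   for q = 9 and q = 27. By Lucas' theorem, concatenating base-p expansions of
   suitable exponents for Q1 and Q2 gives one for Q1 Q2. *)

(** * Lucas' theorem *)

Lemma coef_exprD1n (R : nzSemiRingType) (n i : nat) :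
  (('X + 1 : {poly R}) ^+ n)`_i = 'C(n, i)%:R.
Proof.
rewrite exprD1n coef_sum.
under eq_bigr => j _ do rewrite coefMn coefXn mulrb.
case: (ltnP i n.+1) => [lt_in|lt_ni].
  rewrite (bigD1 (Ordinal lt_in)) //= eqxx big1 ?addr0 // => j.
  by rewrite -val_eqE /= eq_sym => /negbTE->; rewrite mul0rn.
rewrite bin_small // big1 // => j _.
by rewrite gtn_eqF ?mul0rn // (leq_trans (ltn_ord j)).
Qed.

(** Since (X + 1)^(Q + n) = (X^Q + 1)(X + 1)^n, comparing coefficients gives a Pascal rule with step
    [Q]. *)
Lemma lucas (R : comNzRingType) (Q a b a' b' : nat) :
    [pchar R].-nat Q -> (b < Q)%N -> (b' < Q)%N ->
  'C(a * Q + b, a' * Q + b')%:R = 'C(a, a')%:R * 'C(b, b')%:R :> R.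
Proof.
move=> charQ ltbQ ltb'Q.
have step n m : 'C(Q + n, m)%:R =
    'C(n, m)%:R + (if (m < Q)%N then 0 else 'C(n, m - Q)%:R) :> R.
  rewrite -!coef_exprD1n exprD exprDn_pchar; last first.
    by apply: sub_in_pnat charQ => p _; rewrite pchar_poly.
  by rewrite expr1n mulrDl mul1r coefD coefXnM addrC.
elim: a a' => [|a IHa] [|a'].
- by rewrite !mul0n !add0n bin0 mul1r.
- by rewrite bin0n mul0r bin_small // mul0n add0n; lia.
- rewrite mulSn -addnA step mul0n add0n ltb'Q addr0.
  by have := IHa 0; rewrite mul0n add0n !bin0.
rewrite binS natrD mulrDl -!IHa mulSn -addnA step ifN; last by rewrite -leqNgt; lia.
by congr (_ + 'C(_, _)%:R); lia.
Qed.

(** * Exponents for Hermite's criterion *)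

(* Up to sign and a power of t, 'C(2 * k, j) is the coefficient of degree
   k + 2 j = Q - 1 in the k-th power of s (t^2 - s^2)^2, which has degree 5 k. *)
Definition hermite_witness (R : nzRingType) (Q k j : nat) : Prop :=
  [/\ (k + 2 * j + 1 = Q)%N, (5 * k + 2 < 2 * Q)%N & 'C(2 * k, j)%:R != 0 :> R].

(** The bounds make [2 * k2] and [j2] smaller than [Q2], so they are the low digits in [lucas]. *)
Lemma hermite_witness_mul (F : fieldType) (Q1 k1 j1 Q2 k2 j2 : nat) :
    [pchar F].-nat Q2 ->
    hermite_witness F Q1 k1 j1 -> hermite_witness F Q2 k2 j2 ->
  hermite_witness F (Q1 * Q2) (k1 * Q2 + k2) (j1 * Q2 + j2).
Proof.
move=> charQ2 [eq1 lt1 nz1] [eq2 lt2 nz2]; split; [nia|nia|].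
have -> : (2 * (k1 * Q2 + k2) = 2 * k1 * Q2 + 2 * k2)%N by lia.
by rewrite lucas ?mulf_neq0 //; lia.
Qed.

Lemma pchar_fact_neq0 (R : idomainType) (p n : nat) :
  p \in [pchar R] -> (n < p)%N -> n`!%:R != 0 :> R.
Proof.
move=> charp; elim: n => [|n IHn] ltnp; first exact: oner_neq0.
rewrite factS natrM mulf_neq0 ?IHn ?(ltnW ltnp) //.
by rewrite -(dvdn_pcharf charp) gtnNdvd.
Qed.

(** With k = p - 1 - 2j, the condition j <= 2k reads 5j <= 2(p - 1). The largest such j makes k so
    small that 2k < p, and p does not divide (2k)!. *)
Lemma hermite_witness_prime (F : fieldType) (p : nat) :
    p \in [pchar F] -> odd p -> (5 < p)%N ->
  hermite_witness F p (p - 1 - 2 * (2 * (p - 1) %/ 5)) (2 * (p - 1) %/ 5).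
Proof.
move=> charp oddp ltp.
have le_jk : (2 * (p - 1) %/ 5 <= 2 * (p - 1 - 2 * (2 * (p - 1) %/ 5)))%N by lia.
split; [lia|lia|].
apply: contra_neq
  (@pchar_fact_neq0 F p (2 * (p - 1 - 2 * (2 * (p - 1) %/ 5))) charp _); last lia.
by move=> C0; rewrite -(bin_fact le_jk) natrM C0 mul0r.
Qed.

Lemma hermite_witness_exists (F : fieldType) (p n : nat) :
    p \in [pchar F] -> odd p -> (0 < n)%N -> p != 5 -> (3 < p ^ n)%N ->
  exists k j : nat, hermite_witness F (p ^ n) k j.
Proof.
move=> charp oddp n_gt0 pN5.
have pr_p := pcharf_prime charp.
have charX m : [pchar F].-nat (p ^ m)%N by rewrite pnatX pnatE // charp.
have [ltp _|lep] := ltnP 5 p.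
  elim: n n_gt0 => // -[_ _|n IHn _].
    rewrite expn1.
    by eexists; eexists; apply: hermite_witness_prime charp oddp ltp.
  have [//|k [j wkj]] := IHn; rewrite expnS; eexists; eexists.
  by apply: hermite_witness_mul (hermite_witness_prime _ _ charp oddp ltp) wkj.
have p3 : p = 3%N by case: p {charp charX} oddp pN5 pr_p lep => [|[|[|[|[|[|]]]]]].
rewrite {}p3 in charp charX *.
have w9 : hermite_witness F (3 ^ 2) 2 3.
  by split=> //; rewrite -(dvdn_pcharf charp).
have w27 : hermite_witness F (3 ^ 3) 8 9.
  by split=> //; rewrite -(dvdn_pcharf charp).
(* Multiplying by 9 raises the exponent by 2, so 9 and 27 lead to all higher powers. *)
elim/ltn_ind: n n_gt0 => -[|[|[|[|n]]]] IHn //= _ _.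
- by exists 2%N, 3%N.
- by exists 8%N, 9%N.
have [//|//||k [j wkj]] := IHn n.+2.
  by rewrite expnS (leq_ltn_trans _ (ltn_Pmulr _ _)) // ?expn_gt0 // -[X in (X < _)%N](expn0 3) ltn_exp2l.
exists (2 * 3 ^ n.+2 + k)%N, (3 * 3 ^ n.+2 + j)%N.
have -> : (3 ^ n.+4 = 3 ^ 2 * 3 ^ n.+2)%N by rewrite -expnD.
exact: hermite_witness_mul.
Qed.

Definition quintic {R : pzRingType} (t s : R) : R := s * (t ^+ 2 - s ^+ 2) ^+ 2.

Lemma exp_quintic (R : comNzRingType) (t s : R) (k : nat) :
  quintic t s ^+ k = \sum_(i < (2 * k).+1)
    ((-1) ^+ i * (t ^+ 2) ^+ (2 * k - i) * 'C(2 * k, i)%:R) * s ^+ (k + 2 * i).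
Proof.
rewrite exprMn -exprM exprBn mulr_sumr; apply: eq_bigr => i _.
by rewrite exprD [s ^+ (2 * i)]exprM -mulr_natr; ring.
Qed.

(** * Frobenius and the elements of trace zero *)

Section TraceZero.

Variables (F : finFieldType) (q : nat).
Hypotheses (cardF : #|F| = (q ^ 2)%N) (charq : [pchar F].-nat q) (q_gt1 : (1 < q)%N).

Definition trace_zero : pred F := [pred s | s ^+ q == - s].

Lemma frobD (x y : F) : (x + y) ^+ q = x ^+ q + y ^+ q.
Proof. exact: exprDn_pchar. Qed.

Lemma frobN (x : F) : (- x) ^+ q = - x ^+ q.
Proof.
by apply/eqP; rewrite -subr_eq0 opprK -frobD addNr expr0n; case: q q_gt1.
Qed.

Lemma frobB (x y : F) : (x - y) ^+ q = x ^+ q - y ^+ q.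
Proof. by rewrite frobD frobN. Qed.

Lemma frobK (x : F) : (x ^+ q) ^+ q = x.
Proof. by rewrite -exprM mulnn -cardF expf_card. Qed.

Lemma frob_nat (n : nat) : n%:R ^+ q = n%:R :> F.
Proof.
elim: n => [|n IHn]; first by rewrite expr0n; case: q q_gt1.
by rewrite -addn1 natrD frobD IHn expr1n.
Qed.

Lemma exists_generator : {z : F | (q ^ 2 - 1).-primitive_root z}.
Proof.
have q2_gt1 : (1 < q ^ 2)%N by rewrite (ltn_exp2l 0).
have /hasP/sig2W[z _ prim_z] : has (q ^ 2 - 1).-primitive_root (enum [pred x : F | x != 0]).
  apply: has_prim_root; rewrite ?enum_uniq ?subn_gt0 //.
    apply/allP=> x; rewrite mem_enum inE => xN0.
    apply/unity_rootP; apply: (mulfI xN0).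
    by rewrite -exprS subn1 prednK ?(ltnW q2_gt1) // -cardF expf_card mulr1.
  by rewrite -cardE cardC1 cardF subn1.
by exists z.
Qed.

Lemma exists_subfield_root : exists b : F, (q - 1).-primitive_root b.
Proof.
have [z prim_z] := exists_generator; exists (z ^+ q.+1).
have := exp_prim_root prim_z q.+1.
have -> : (q ^ 2 - 1 = (q - 1) * q.+1)%N by rewrite expnS expn1; nia.
by rewrite (gcdn_idPl _) ?dvdn_mull // mulnK.
Qed.

(** For a generator z, take z^((q + 1) / 2): its (q - 1)-th power squares to 1 but is not 1. *)
Lemma exists_trace_zero : odd q -> exists2 a : F, a != 0 & a \in trace_zero.
Proof.
move=> oddq; have [z prim_z] := exists_generator.
have zN0 : z != 0.
  have q2_gt1 : (1 < q ^ 2)%N by rewrite (ltn_exp2l 0).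
  by rewrite (prim_root_eq0 prim_z) subn_eq0 -ltnNge.
have [m qE] : exists m, q = (2 * m + 1)%N by exists q./2; lia.
have m_gt0 : (0 < m)%N by lia.
have nE : (q ^ 2 - 1 = 2 * (m * m.+1).*2)%N by rewrite qE; nia.
exists (z ^+ m.+1); first by rewrite expf_neq0.
have eq_mq : (m.+1 * q = (m * m.+1).*2 + m.+1)%N by rewrite qE; nia.
rewrite inE -exprM eq_mq exprD -mulN1r; apply/eqP; congr (_ * _).
have /eqP := prim_expr_order prim_z; rewrite nE mulnC exprM sqrf_eq1.
by case/pred2P=> // /eqP; rewrite -(prim_order_dvd prim_z) nE gtnNdvd //; nia.
Qed.

Lemma trace_zeroD (s w : F) : w \in trace_zero -> (w + s \in trace_zero) = (s \in trace_zero).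
Proof. by rewrite !inE frobD opprD => /eqP->; rewrite (inj_eq (addrI _)). Qed.

Lemma trace_zeroM (b s : F) :
  b != 0 -> b ^+ q = b -> (b * s \in trace_zero) = (s \in trace_zero).
Proof. by move=> bN0 bq; rewrite !inE exprMn bq -mulrN (inj_eq (mulfI bN0)). Qed.

(** * Power sums over the elements of trace zero *)

(* The set of elements of trace zero is a group, so translating by a nonzero
   element [w] of it gives [n * w = 0], where [n] is its cardinality. *)
Lemma card_trace_zero : odd q -> \sum_(s in trace_zero) (1 : F) = 0.
Proof.
move=> oddq; have [w wN0 wS] := exists_trace_zero oddq.
apply: (mulIf wN0); rewrite mul0r mulr_suml.
have : \sum_(s in trace_zero) s = \sum_(s in trace_zero) (w + s).
  rewrite (reindex_inj (addrI w)); apply: eq_bigl => s.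
  exact: trace_zeroD.
move/eqP; rewrite big_split /= -subr_eq0 -opprB oppr_eq0 addrK => /eqP w0.
by rewrite -[RHS]w0; apply: eq_bigr => s _; rewrite mul1r.
Qed.

Lemma trace_zero_unity (s : F) : s != 0 -> s \in trace_zero -> s ^+ (q - 1) = -1.
Proof.
move=> sN0 /eqP sq; apply: (mulfI sN0).
by rewrite -exprS subn1 prednK ?(ltnW q_gt1) // sq mulrN1.
Qed.

(** Each nonzero s contributes -1, and by [card_trace_zero] their number is -1 in [F]. *)
Lemma sum_trace_zero_unity : odd q -> \sum_(s in trace_zero) s ^+ (q - 1) = 1.
Proof.
move=> oddq; have S0 : 0 \in trace_zero by rewrite inE oppr0 expr0n; case: q q_gt1.
rewrite (bigD1 0) //= expr0n subn_eq0 leqNgt q_gt1 add0r.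
rewrite (eq_bigr (fun=> -1)) => [|s /andP[sS sN0]]; last exact: trace_zero_unity.
by have := card_trace_zero oddq; rewrite (bigD1 0) //= sumrN => /eqP; rewrite addr_eq0 => /eqP <-.
Qed.

(** Scaling by a generator b of F_q^* permutes the summation range and multiplies the sum by b^n,
    which is not 1. *)
Lemma sum_trace_zero_expr_small (n : nat) :
  (0 < n < q - 1)%N -> \sum_(s in trace_zero) s ^+ n = 0.
Proof.
case/andP=> n_gt0 ltnq; have [b prim_b] := exists_subfield_root.
have bN0 : b != 0.
  by rewrite (prim_root_eq0 prim_b) subn_eq0 -ltnNge.
have bq : b ^+ q = b.
  by rewrite -(subnK (ltnW q_gt1)) exprD (prim_expr_order prim_b) mul1r.
have bn : b ^+ n != 1 by rewrite -(prim_order_dvd prim_b) gtnNdvd.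
have : \sum_(s in trace_zero) s ^+ n = b ^+ n * \sum_(s in trace_zero) s ^+ n.
  rewrite [LHS](reindex_inj (mulfI bN0)) mulr_sumr; apply: eq_big => s.
    exact: trace_zeroM.
  by rewrite exprMn.
move/eqP; rewrite -subr_eq0 -[X in X - _]mul1r -mulrBl mulf_eq0 subr_eq0 eq_sym.
by rewrite (negPf bn) /= => /eqP.
Qed.

Lemma sum_trace_zero_expr (n : nat) :
    (0 < n < 2 * (q - 1))%N -> n != (q - 1)%N ->
  \sum_(s in trace_zero) s ^+ n = 0.
Proof.
case/andP=> n_gt0 ltnq nN; case: ltngtP nN => // [ltnq1|ltqn] _.
  by apply: sum_trace_zero_expr_small; rewrite n_gt0.
have -> : \sum_(s in trace_zero) s ^+ n = - \sum_(s in trace_zero) s ^+ (n - (q - 1)).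
  rewrite -sumrN; apply: eq_bigr => s sS.
  have [->|sN0] := eqVneq s 0.
    by rewrite !expr0n gtn_eqF // subn_eq0 leqNgt ltqn oppr0.
  by rewrite -{1}(subnK (ltnW ltqn)) exprD trace_zero_unity // mulrN1.
by rewrite sum_trace_zero_expr_small ?oppr0 // subn_gt0 ltqn ltn_subLR ?(ltnW ltqn) // addnn -mul2n.
Qed.


(** * Injectivity of the quintic *)

Lemma trace_zero_quintic (t s : F) :
  t ^+ q = t -> s \in trace_zero -> quintic t s \in trace_zero.
Proof.
rewrite !inE => tq /eqP sq; rewrite exprMn (exprAC _ 2 q) frobB !(exprAC _ 2 q) tq sq.
by rewrite sqrrN mulNr.
Qed.

(* Hermite's criterion: if the quintic permuted the elements of trace zero, its
   [k]-th power would sum to the power sum of exponent [k], which is zero, but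
   only the monomial of degree [q - 1] contributes. *)
Lemma quintic_not_inj (t : F) (k j : nat) :
    odd q -> t != 0 -> t ^+ q = t -> hermite_witness F q k j ->
  ~ {in trace_zero &, injective (quintic t)}.
Proof.
move=> oddq tN0 tq [eqk ltk nzC] inj.
have k_gt0 : (0 < k)%N.
  by case: k eqk {ltk} nzC => // eqj; rewrite bin_small ?eqxx //; lia.
have lej : (j < (2 * k).+1)%N by rewrite ltnS leqNgt; apply: contra nzC => /bin_small->.
have sumk : \sum_(s in trace_zero) quintic t s ^+ k = 0.
  transitivity (\sum_(s in trace_zero) s ^+ k); last by apply: sum_trace_zero_expr; lia.
  pose S := [set s in trace_zero].
  have imS : quintic t @: S = S.
    apply/eqP; rewrite eqEcard card_in_imset ?leqnn ?andbT; last first.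
      by move=> x y; rewrite !inE; apply: inj.
    apply/subsetP=> _ /imsetP[s + ->]; rewrite !in_set; exact: trace_zero_quintic.
  have sumS G : \sum_(s in trace_zero) G s = \sum_(s in S) G s :> F.
    by apply: eq_bigl => s; rewrite in_set.
  rewrite !sumS -[in RHS]imS big_imset //= => x y; rewrite !in_set; exact: inj.
move: sumk; under eq_bigr do rewrite exp_quintic.
(* All degrees k + 2i lie strictly between 0 and 2(q - 1), so only degree q - 1 survives. *)
rewrite exchange_big /= (bigD1 (Ordinal lej)) //= [X in _ + X]big1 => [|i]; last first.
  rewrite -val_eqE /= => iNj; rewrite -mulr_sumr sum_trace_zero_expr ?mulr0 //; last lia.
  by have := ltn_ord i; lia.
have -> : (k + 2 * j = q - 1)%N by lia.
rewrite addr0 -mulr_sumr sum_trace_zero_unity // mulr1 => /eqP.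
by rewrite !mulf_eq0 (negPf nzC) !expf_eq0 (negPf tN0) oppr_eq0 oner_eq0 !andbF.
Qed.

Lemma two_neq0 : odd q -> 2%:R != 0 :> F.
Proof.
move=> oddq; apply/negP => two0; have ch2 : 2 \in [pchar F] by rewrite inE.
by move: charq; rewrite (eq_pnat _ (pcharf_eq ch2)) => /p_natP[[|n] e]; 
  move: oddq q_gt1; rewrite e // oddX.
Qed.

Lemma trace_zero_fixed (s : F) : odd q -> s \in trace_zero -> s ^+ q = s -> s = 0.
Proof.
move=> oddq /eqP-> /eqP; rewrite eq_sym -subr_eq0 opprK -mulr2n -mulr_natl mulf_eq0.
by rewrite (negPf (two_neq0 oddq)) /= => /eqP.
Qed.

(* Writing A = x + y, B = xy and c = t^2, the difference quotient of the quintic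
   at x and y is B^2 + (2c - 3A^2) B + (A^2 - c)^2, a quadratic in B of
   discriminant A^2 (5A^2 - 4c), which is the square (At)^2 when 5 = 0. *)
Lemma quintic_inj_char5 (t : F) :
    odd q -> 5 \in [pchar F] -> t != 0 -> t ^+ q = t ->
  {in trace_zero &, injective (quintic t)}.
Proof.
move=> oddq char5 tN0 tq x y xS yS eq_xy; apply/eqP; apply: contraNT tN0 => xNy.
have E0 : (x * y) ^+ 2 + (2 * t ^+ 2 - 3 * (x + y) ^+ 2) * (x * y)
    + ((x + y) ^+ 2 - t ^+ 2) ^+ 2 = 0.
  apply: (@mulfI _ (x - y)); first by rewrite subr_eq0.
  by rewrite mulr0 -[RHS](subrr (quintic t y)) -{1}eq_xy /quintic; ring.
have five0 : 5 = 0 :> F by apply: pcharf0.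
(* [M] is the derivative of the quadratic at B, so its square is the discriminant. As [M] lies in
   F_q and [At] has trace zero, [At] must vanish. *)
pose M := 2 * (x * y) + 2 * t ^+ 2 - 3 * (x + y) ^+ 2.
pose At := (x + y) * t.
have Mq : M ^+ q = M.
  rewrite /M frobB frobD exprMn [(2 * _) ^+ q]exprMn [(3 * _) ^+ q]exprMn.
  rewrite [(x * y) ^+ q]exprMn !(exprAC _ 2 q) !frob_nat [(x + y) ^+ q]frobD (eqP xS) (eqP yS) tq.
  by ring.
have Atq : At ^+ q = - At.
  by rewrite /At exprMn frobD (eqP xS) (eqP yS) tq; ring.
have M2 : M ^+ 2 = At ^+ 2.
  transitivity (At ^+ 2 + 5 * ((x + y) ^+ 2 * ((x + y) ^+ 2 - t ^+ 2)) + 4 * 0).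
    by rewrite -[in RHS]E0 /M /At; ring.
  by rewrite five0 mul0r mulr0 !addr0.
have At0 : At = 0.
  apply: trace_zero_fixed oddq _ _; first exact/eqP.
  by move/eqP: M2; rewrite eqf_sqr => /pred2P[<-//|eM]; rewrite -[At]opprK -eM frobN Mq.
move/eqP: At0; rewrite mulf_eq0 => /orP[|//]; rewrite addr_eq0 => /eqP xE.
have : (t - y) * (t + y) == 0.
  rewrite -sqrf_eq0; apply/eqP; rewrite -[RHS]E0 xE; ring.
rewrite mulf_eq0 subr_eq0 addr_eq0.
have yN t' : t' \in trace_zero -> t' ^+ q = t' -> t' == 0.
  by move=> h1 h2; apply/eqP/trace_zero_fixed.
case/orP=> /eqP tE.
  by apply: yN => //; rewrite tE.
by apply: yN => //; rewrite tE inE frobN (eqP yS).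
Qed.

(** Ratios of nonzero elements of trace zero lie in F_q, so collisions of s^5 come from fifth roots
    of unity in F_q; nontrivial ones exist exactly when 5 divides q - 1. *)
Lemma quintic0_injP :
  odd q -> {in trace_zero &, injective (quintic (0 : F))} <-> (q %% 5 != 1)%N.
Proof.
move=> oddq; have quintic0 s : quintic 0 s = s ^+ 5 :> F by rewrite /quintic; ring.
split=> [inj|qN1 x y xS yS]; last first.
  rewrite !quintic0 => xy5; have [y0|yN0] := eqVneq y 0.
    by move/eqP: xy5; rewrite y0 expr0n expf_eq0 => /eqP.
  pose r := x / y; have r5 : r ^+ 5 = 1 by rewrite expr_div_n xy5 divff ?expf_neq0.
  suff r1 : r = 1 by rewrite -[x](divfK yN0) -/r r1 mul1r.
  have rq : r ^+ (q %% 5) = r.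
    have : r ^+ q = r by rewrite expr_div_n (eqP xS) (eqP yS) invrN mulrNN.
    by rewrite {1}(divn_eq q 5) exprD mulnC exprM r5 expr1n mul1r.
  have rN0 : r != 0 by apply: contra_eq_neq r5 => ->; rewrite expr0n eq_sym oner_eq0.
  have : (q %% 5 < 5)%N by rewrite ltn_mod.
  have r5E : r ^+ 5 = r ^+ 4 * r by rewrite -exprSr.
  have r4E : r ^+ 4 = (r ^+ 2) ^+ 2 by rewrite -exprM.
  move: qN1 rq; case: (q %% 5)%N => [|[|[|[|[|]]]]] // _ rq _.
  - by apply: (mulIf rN0); rewrite mul1r -expr2.
  - have r2 : r ^+ 2 = 1 by apply: (mulIf rN0); rewrite mul1r -exprSr.
    by rewrite -r5 r5E r4E r2 expr1n mul1r.
  - have r2 : r ^+ 2 = 1 by rewrite expr2 -{1}rq -r5E.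
    by rewrite -rq r4E r2 expr1n.
apply/negP=> /eqP q1; have [b prim_b] := exists_subfield_root.
have [a aN0 aS] := exists_trace_zero oddq.
have bN0 : b != 0 by rewrite (prim_root_eq0 prim_b) subn_eq0 -ltnNge.
have bq : b ^+ q = b.
  by rewrite -(subnK (ltnW q_gt1)) exprD (prim_expr_order prim_b) mul1r.
have := inj (b ^+ ((q - 1) %/ 5) * a) a.
rewrite trace_zeroM ?expf_neq0 //; last by rewrite exprAC bq.
rewrite !quintic0 exprMn -exprM divnK; last by lia.
rewrite (prim_expr_order prim_b) mul1r => /(_ aS aS erefl) /eqP.
rewrite -subr_eq0 -{2}[a]mul1r -mulrBl mulf_eq0 (negPf aN0) orbF subr_eq0.
by rewrite -(prim_order_dvd prim_b) gtnNdvd //; lia.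
Qed.


(** * Reduction of f to the quintic *)

(** The difference f^q - f determines s, hence u, and then f determines Tr x. Conversely, a
    collision of the quintic lifts to one of f by adjusting Tr x. *)
Lemma permutation_iff_quintic_inj (delta gamma : F) :
    odd q -> gamma ^+ q = gamma -> gamma != 0 ->
  permutation_polynomial
    (('X^q - 'X + delta%:P) ^+ (3 * q + 2) + gamma *: ('X^q + 'X))
  <-> {in trace_zero &, injective (quintic (Tr q delta))}.
Proof.
move=> oddq gammaq gN0; pose t := Tr q delta.
have two0 := two_neq0 oddq.
pose u (x : F) := x ^+ q - x + delta.
pose f (x : F) := u x ^+ (3 * q + 2) + gamma * (x ^+ q + x).
have fE x : (('X^q - 'X + delta%:P) ^+ (3 * q + 2) + gamma *: ('X^q + 'X)).[x] = f x.
  by rewrite !hornerE.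
have tq : t ^+ q = t by rewrite /t /Tr frobD frobK addrC.
have uq x : u x ^+ q = t - u x.
  by rewrite /u frobD frobB frobK /t /Tr; ring.
have uXq x : u x ^+ (3 * q + 2) = (t - u x) ^+ 3 * u x ^+ 2.
  by rewrite exprD mulnC exprM uq.
(* [16 (f^q - f)] is the quintic of the trace-zero element [u - u^q = 2 u - t] *)
have quinticE x : quintic t (2 * u x - t) =
    16 * ((u x ^+ (3 * q + 2)) ^+ q - u x ^+ (3 * q + 2)).
  rewrite uXq exprMn (exprAC _ 3 q) (exprAC _ 2 q) frobB tq uq /quintic.
  by ring.
have uS x : 2 * u x - t \in trace_zero.
  by rewrite inE frobB exprMn frob_nat tq uq; apply/eqP; ring.
have sixteenN0 : 16 != 0 :> F.
  have -> : 16 = 2 ^+ 4 :> F by ring.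
  by rewrite expf_neq0.
have bijE : permutation_polynomial
    (('X^q - 'X + delta%:P) ^+ (3 * q + 2) + gamma *: ('X^q + 'X)) <-> injective f.
  split=> [/bij_inj injf x y|injf]; first by rewrite -!fE; apply: injf.
  by apply: (@eq_bij _ _ f (injF_bij injf)) => x; rewrite fE.
rewrite bijE; split=> [injf s1 s2 s1S s2S eq_s|injP x y eq_f]; last first.
  have fq z : f z ^+ q - f z = (u z ^+ (3 * q + 2)) ^+ q - u z ^+ (3 * q + 2).
    by rewrite /f frobD [(gamma * _) ^+ q]exprMn frobD frobK gammaq; ring.
  have : 2 * u x - t = 2 * u y - t.
    by apply: injP => //; rewrite !quinticE -!fq eq_f.
  move/addIr/(mulfI two0) => eq_u.
  move: eq_f; rewrite /f eq_u => /addrI/(mulfI gN0) eq_tr.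
  move: eq_u => /addIr eq_d; apply: (mulfI two0).
  by transitivity ((x ^+ q + x) - (x ^+ q - x)); [ring | rewrite eq_tr eq_d; ring].
(* the element [x] with trace [T] and [2 * u x - t = s] *)
pose X (s T : F) := (T - (s + t - 2 * delta) / 2) / 2.
have Xq s T : s \in trace_zero -> T ^+ q = T -> X s T ^+ q = (T + (s + t - 2 * delta) / 2) / 2.
  move=> /eqP sS Tq; rewrite /X exprMn exprVn frob_nat frobB Tq exprMn exprVn frob_nat.
  rewrite frobB frobD tq sS [(2 * _) ^+ q]exprMn frob_nat /t /Tr.
  by field.
have uX s T : s \in trace_zero -> T ^+ q = T -> u (X s T) = (s + t) / 2.
  by move=> sS Tq; rewrite /u Xq // /X; field.
have trX s T : s \in trace_zero -> T ^+ q = T -> X s T ^+ q + X s T = T.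
  by move=> sS Tq; rewrite Xq // /X; field.
have sE s T : s \in trace_zero -> T ^+ q = T -> 2 * u (X s T) - t = s.
  by move=> sS Tq; rewrite uX //; field.
have zq : 0 ^+ q = 0 :> F by exact: (frob_nat 0).
pose w s := u (X s 0) ^+ (3 * q + 2).
(* This trace compensates the difference of the two powers, which lies in F_q because the quintics
   agree. *)
pose T := (w s1 - w s2) / gamma.
have Tq : T ^+ q = T.
  rewrite /T exprMn exprVn gammaq frobB; congr (_ / _).
  have : 16 * (w s1 ^+ q - w s1) = 16 * (w s2 ^+ q - w s2).
    by rewrite -!quinticE !sE.
  move/(mulfI sixteenN0)/eqP; rewrite subr_eq => /eqP->; ring.
have : X s1 0 = X s2 T.
  apply: injf; rewrite /f !trX // -/(w s1) mulr0 addr0.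
  rewrite uX // -(uX s2 0) // -/(w s2) /T; field.
  exact: gN0.
by move=> eqX; rewrite -(sE s1 0) // eqX sE.
Qed.

End TraceZero.

(* The last hypothesis removes the only false instances of the published claim:
   if q = 3 then u ^+ (3 * q + 2) = u ^+ 3 on F_9, so that f is affine over F_3
   and permutes F_9 for every delta, whatever its trace. *)
Theorem theorem3p15 (q : nat) (F : finFieldType) (delta gamma : F)
    (q_prime_power : prime_power q) (q_odd : odd q)
    (cardF : #|F| = (q ^ 2)%N)
    (gamma_Fq : gamma \in subfield_q q) (gamma_neq0 : gamma != 0)
    (q3 : q = 3%N -> Tr q delta = 0) :
  permutation_polynomial
    (('X^q - 'X + delta%:P) ^+ (3 * q + 2) + gamma *: ('X^q + 'X))
  <->
  (q = 0 %[mod 5])%N \/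
  ([\/ (q = 2 %[mod 5])%N, (q = 3 %[mod 5])%N | (q = 4 %[mod 5])%N]
   /\ Tr q delta = 0).
Proof.
have [p [n [pr_p n_gt0 qE]]] := q_prime_power.
have charp : p \in [pchar F].
  by apply: (@card_finPcharP _ p (n * 2)); rewrite // cardF qE -expnM.
have charq : [pchar F].-nat q by rewrite qE pnatX pnatE // charp.
have q_gt1 : (1 < q)%N by rewrite qE -(exp1n n) ltn_exp2r // prime_gt1.
have tq : Tr q delta ^+ q = Tr q delta.
  by rewrite /Tr (frobD _ _ charq) (frobK _ _ cardF) addrC.
rewrite (permutation_iff_quintic_inj _ _ cardF) //; last exact/eqP.
have [t0|tN0] := eqVneq (Tr q delta) 0.
  rewrite t0 (quintic0_injP _ _ cardF) //.
  have : (q %% 5 < 5)%N by rewrite ltn_mod.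
  case: (q %% 5)%N => [|[|[|[|[|]]]]] // _; split=> //.
  - by left.
  - by case=> [|[[]]].
  - by right; split=> //; constructor 1.
  - by right; split=> //; constructor 2.
  - by right; split=> //; constructor 3.
have [p5|pN5] := eqVneq p 5.
  rewrite p5 in charp qE; split=> _.
    by left; apply/eqP; rewrite mod0n -/(dvdn 5 q) qE dvdn_exp.
  exact: quintic_inj_char5.
split=> [injP|[q0|[_ /eqP]]]; last by rewrite (negPf tN0).
  have oddp : odd p by move: q_odd; rewrite qE oddX; case: n n_gt0 {qE}.
  (* No witness exists for q = 3, which [q3] excludes when the trace is nonzero. *)
  have q_gt3 : (3 < p ^ n)%N.
    rewrite -qE ltn_neqAle; apply/andP; split; last by move: q_odd q_gt1; lia.
    by apply: contraNneq tN0 => q_eq3; rewrite q3.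
  have [k [j]] := hermite_witness_exists F p n charp oddp n_gt0 pN5 q_gt3.
  by rewrite -qE => /(quintic_not_inj _ _ cardF charq q_gt1 _ _ _ q_odd tN0 tq) [].
case/negP: pN5; rewrite eq_sym -(dvdn_prime2 _ pr_p) //.
by move/eqP: q0; rewrite mod0n -/(dvdn 5 q) qE Euclid_dvdX // => /andP[].
Qed.
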